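(* For all integers $k\ge2$ and $m,n\ge0$, let $$H(k,m,n)=\frac{(km+(k+1)(n+1))!}{(k(m+n+1)+1)(m+n+1)\,((k-1)m+k(n+1))!\,m!\,n!}.$$ Then $G(m\vec k+n(\overrightarrow{k+1}))=H(k,m,n)$, i.e. the coefficient of $t_k^m t_{k+1}^n$ in the Geode $\mathbf G$ equals $H(k,m,n)$.
   Context: A type is a vector $\mathbf m=[m_2,m_3,\ldots]$ of natural numbers (indices start at $2$) with finitely many nonzero entries; $\vec j$ is the type with $1$ in position $j$ and $0$ elsewhere, and $\mathbf t^{\mathbf m}=t_2^{m_2}t_3^{m_3}\cdots$. The hyper-Catalan number is $C_{\mathbf m}=\frac{(2m_2+3m_3+4m_4+\cdots)!}{(1+m_2+2m_3+3m_4+\cdots)!\,m_2!\,m_3!\cdots}$ and $\mathbf S=\sum_{\mathbf m}C_{\mathbf m}\mathbf t^{\mathbf m}$. The Geode $\mathbf G$ is the unique formal power series with $\mathbf S-1=(t_2+t_3+t_4+\cdots)\mathbf G$, and $G(\mathbf n)$ is its coefficient of $\mathbf t^{\mathbf n}$. *)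

(* Defs.v *)
From HB Require Import structures.
From mathcomp Require Import all_boot all_order all_algebra.
From mathcomp Require Import finmap.
From mathcomp Require Import boolp classical_sets functions cardinality fsbigop.

Set Implicit Arguments.
Unset Strict Implicit.
Unset Printing Implicit Defensive.

Import Order.TTheory GRing.Theory Num.Theory.

Local Open Scope fset_scope.
Local Open Scope classical_set_scope.
Local Open Scope ring_scope.

Definition tindex : choiceType := {j : nat | (2 <= j)%N}.

Definition idx (j : nat) (hj : (2 <= j)%N) : tindex := exist _ j hj.
Arguments idx : clear implicits.

Definition mtype : choiceType := {fsfun tindex -> nat with 0%N}.

Definition mzero : mtype := [fsfun with 0%N].

Definition vec (j : tindex) : mtype := [fsfun mzero with j |-> 1%N].

Definition madd (a b : mtype) : mtype :=
  [fsfun j in (finsupp a `|` finsupp b)%fset => (a j + b j)%N].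

Definition mscale (c : nat) (a : mtype) : mtype :=
  [fsfun j in finsupp a => (c * a j)%N].

(* A formal power series in t_2, t_3, ... over the rationals is the family
   of its coefficients: F m is the coefficient of t^m. *)
Definition series : Type := mtype -> rat.

Definition sone : series := fun m => (m == mzero)%:R.

(* The formal sum t_2 + t_3 + t_4 + ... *)
Definition svars : series := fun m => `[< exists j : tindex, m = vec j >]%:R.

(* Cauchy product; the index set of the sum is finite (finite_splits below). *)
Definition smul (F G : series) : series :=
  fun m => \sum_(p \in [set p : mtype * mtype | madd p.1 p.2 = m])
             F p.1 * G p.2.

Definition hyperCatalan (m : mtype) : rat :=
  ((\sum_(j <- finsupp m) val j * m j)`!)%N%:R /
  ((1 + \sum_(j <- finsupp m) (val j).-1 * m j)`! *
   \prod_(j <- finsupp m) (m j)`!)%N%:R.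

Definition hyperCatalan_series : series := hyperCatalan.

Definition is_geode (G : series) : Prop :=
  hyperCatalan_series \- sone = smul svars G.

Lemma maddE a b j : madd a b j = (a j + b j)%N.
Proof.
rewrite fsfunE in_fsetU; case: finsuppP => //= _; case: finsuppP => //=.
Qed.

Lemma mscaleE c a j : mscale c a j = (c * a j)%N.
Proof. by rewrite fsfunE; case: finsuppP => //= _; rewrite muln0. Qed.

Lemma vecE j i : vec j i = (i == j).
Proof. by rewrite /vec fsfun_withE fsfunE; case: eqP. Qed.

Lemma mzeroE j : mzero j = 0%N.
Proof. by rewrite fsfunE. Qed.

Lemma maddC : commutative madd.
Proof. by move=> a b; apply/fsfunP => j; rewrite !maddE addnC. Qed.

Lemma maddA : associative madd.
Proof. by move=> a b c; apply/fsfunP => j; rewrite !maddE addnA. Qed.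

Lemma madd0 a : madd a mzero = a.
Proof. by apply/fsfunP => j; rewrite !maddE mzeroE addn0. Qed.

Lemma maddI a : injective (madd a).
Proof.
move=> b c e; apply/fsfunP => j.
by move/fsfunP/(_ j): e; rewrite !maddE => /addnI.
Qed.

Lemma in_supp (a : mtype) j : (j \in finsupp a) = (0 < a j)%N.
Proof. by rewrite mem_finsupp lt0n. Qed.

Definition mpred (m : mtype) (j : tindex) : mtype :=
  [fsfun i in finsupp m => (m i - (i == j))%N].

Lemma mpredE (m : mtype) j i : mpred m j i = (m i - (i == j))%N.
Proof. by rewrite fsfunE; case: finsuppP. Qed.

Lemma mpredK (m : mtype) j : (0 < m j)%N -> madd (mpred m j) (vec j) = m.
Proof.
move=> h; apply/fsfunP => i; rewrite maddE mpredE vecE.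
by case: eqP => [->|_]; rewrite ?subnK // ?subn0 ?addn0.
Qed.

Lemma maddK m j : mpred (madd m (vec j)) j = m.
Proof. by apply/fsfunP => i; rewrite mpredE maddE vecE addnK. Qed.

Definition splits m := [set p : mtype * mtype | madd p.1 p.2 = m].

Lemma finite_splits m : finite_set (splits m).
Proof.
pose N := \max_(j : finsupp m) m (val j).
pose fin := {ffun finsupp m -> 'I_N.+1}.
pose h (f : fin) : mtype := [fsfun i : finsupp m => nat_of_ord (f i)].
apply: (@sub_finite_set _ _ [set p | exists f g : fin, p = (h f, h g)]).
  have key a b : madd a b = m -> exists f : fin, a = h f.
    move=> e; exists [ffun i => inord (a (val i))].
    apply/fsfunP => i; have [im|im] := boolP (i \in finsupp m).
      rewrite fsfun_ffun insubT /= ffunE inordK //= ltnS.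
      apply: (@leq_trans (m i)); first by rewrite -e maddE leq_addr.
      exact: (leq_bigmax (F := fun j : finsupp m => m (val j)) [` im]).
    have : (a i + b i)%N == 0%N by rewrite -maddE e fsfun_dflt.
    rewrite addn_eq0 => /andP[/eqP-> _].
    by rewrite fsfun_ffun insubF //; apply/negbTE.
  move=> [a b] /= e; have [f ef] := key a b e.
  by have [g eg] := key b a (etrans (maddC _ _) e); exists f, g; rewrite ef eg.
apply: (@sub_finite_set _ _ ((fun p : fin * fin => (h p.1, h p.2)) @` setT)).
  by move=> _ [f [g ->]]; exists (f, g).
by apply: finite_image; apply: finite_finset.
Qed.


Lemma smul_svars G m :
  smul svars G m = \sum_(j <- finsupp m) G (mpred m j).
Proof.
rewrite fsbig_seq ?fset_uniq // /smul.
pose h j := (vec j, mpred m j).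
have inj : set_inj [set` finsupp m] h.
  move=> i j _ _ [/fsfunP/(_ i)]; rewrite !vecE eqxx.
  by case: eqP.
rewrite -(fsbig_widen (h @` [set` finsupp m]) (splits m)); first last.
- move=> [a b] /= [e]; rewrite /splits /= in e => nh; rewrite /preimage /=.
  rewrite /svars; case: asboolP => [[j aj]|_]; last by rewrite mul0r.
  case: nh; exists j => /=.
    by rewrite in_supp -e maddE aj vecE eqxx.
  by rewrite /h aj -e aj maddC maddK.
- move=> _ [j /= jm <-]; rewrite /splits /= maddC mpredK //.
  by rewrite -in_supp.
rewrite fsbig_image //; apply: eq_fsbigr => j _ /=.
rewrite /svars; case: asboolP => [_|[]]; first by rewrite mul1r.
by exists j.
Qed.

Section BigType.
Variables (idx0 : nat) (op : Monoid.com_law idx0) (f : tindex -> nat -> nat).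
Hypothesis f0 : forall i, f i 0 = idx0.

Lemma big_supp (m : mtype) (B : {fset tindex}) : (finsupp m `<=` B)%fset ->
  \big[op/idx0]_(i <- finsupp m) f i (m i) = \big[op/idx0]_(i <- B) f i (m i).
Proof.
by move=> sB; apply: big_fset_incl => // i _ im; rewrite fsfun_dflt.
Qed.

Lemma big_addvec (a : mtype) j : exists r,
  \big[op/idx0]_(i <- finsupp (madd a (vec j))) f i (madd a (vec j) i)
    = op (f j (a j).+1) r
  /\ \big[op/idx0]_(i <- finsupp a) f i (a i) = op (f j (a j)) r.
Proof.
pose B := (j |` finsupp a)%fset.
have jB : j \in B by rewrite !inE eqxx.
exists (\big[op/idx0]_(i <- (B `\ j)%fset) f i (a i)); split.
  rewrite (@big_supp _ B); last first.
    apply/fsubsetP => i; rewrite in_supp maddE vecE !inE in_supp.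
    by case: eqP => //=; rewrite addn0.
  rewrite (big_fsetD1 j) //= maddE vecE eqxx addn1; congr (op _ _).
  rewrite !big_seq; apply: eq_bigr => i; rewrite !inE => /andP[/negbTE ij _].
  by rewrite maddE vecE ij addn0.
rewrite (@big_supp _ B); first by rewrite (big_fsetD1 j).
by apply/fsubsetP => i; rewrite !inE => ->; rewrite orbT.
Qed.

End BigType.

Definition mdeg (m : mtype) := (\sum_(j <- finsupp m) m j)%N.
Definition mwt (m : mtype) := (\sum_(j <- finsupp m) val j * m j)%N.
Definition mfac (m : mtype) := (\prod_(j <- finsupp m) (m j)`!)%N.

Lemma mdegS m j : mdeg (madd m (vec j)) = (mdeg m).+1.
Proof.
rewrite /mdeg.
have [//|r [-> ->]] := @big_addvec _ addn (fun _ k => k) _ m j.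
by [].
Qed.

Lemma mwtS m j : mwt (madd m (vec j)) = (mwt m + val j)%N.
Proof.
rewrite /mwt.
have [|r [-> ->]] := @big_addvec _ addn (fun i k => val i * k)%N _ m j.
  by move=> i; rewrite muln0.
by rewrite /= mulnS -addnA addnC.
Qed.

Lemma mfacS m j : mfac (madd m (vec j)) = ((m j).+1 * mfac m)%N.
Proof.
rewrite /mfac.
have [//|r [-> ->]] := @big_addvec _ muln (fun i k => k`!)%N _ m j.
by rewrite /= factS mulnA.
Qed.

Lemma mdeg_eq0 m : (mdeg m == 0%N) = (m == mzero).
Proof.
apply/idP/eqP => [|->]; last by rewrite /mdeg finsupp0 big_seq_fset0.
move=> h; apply/fsfunP => j; rewrite mzeroE; apply/eqP; apply: contraLR h => h.
have mj : (0 < m j)%N by rewrite lt0n.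
by rewrite -(mpredK mj) mdegS.
Qed.

Lemma leq_mdeg (m : mtype) j : (m j <= mdeg m)%N.
Proof.
case: (finsuppP m j) => // jm.
by rewrite /mdeg (big_fsetD1 j) //= leq_addr.
Qed.

Lemma mdegP m : (0 < mdeg m)%N -> exists j : tindex, (0 < m j)%N.
Proof.
case: (fset_0Vmem (finsupp m)) => [e|[j]].
  by rewrite /mdeg e big_seq_fset0.
by rewrite in_supp; exists j.
Qed.

Lemma mfac_neq0 m : (mfac m)%:R != 0 :> rat.
Proof.
rewrite pnatr_eq0 -lt0n /mfac; elim/big_ind: _ => // [x y hx hy|i _].
  by rewrite muln_gt0 hx.
exact: fact_gt0.
Qed.

Lemma sumsupp_mdeg (m b : mtype) : (forall j, b j <= m j)%N ->
  (\sum_(j <- finsupp m) b j)%N = mdeg b.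
Proof.
move=> le; apply/esym/(@big_supp _ addn (fun _ k => k)) => //.
by apply/fsubsetP => i; rewrite !in_supp => h; apply: leq_trans h (le i).
Qed.

Definition wgt (p : mtype * mtype) : rat := ((mfac p.1)%:R * (mfac p.2)%:R)^-1.

Lemma sum_splits1 m j (psi : mtype * mtype -> rat) :
  \sum_(p \in splits (madd m (vec j))) (p.1 j)%:R * (psi p * wgt p) =
  \sum_(p \in splits m) psi (madd p.1 (vec j), p.2) * wgt p.
Proof.
pose h (p : mtype * mtype) := (madd p.1 (vec j), p.2).
have inj : set_inj (splits m) h.
  move=> [a b] [c d] _ _ [/= e ->]; congr pair.
  by move: e; rewrite ![madd _ (vec j)]maddC => /maddI.
rewrite -(fsbig_widen (h @` splits m)); first last.
- move=> [a b] /= [e nh]; rewrite /splits /= in e; rewrite /preimage /=.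
  case: (posnP (a j)) => [->|aj]; first by rewrite mul0r.
  case: nh; exists (mpred a j, b); last by rewrite /h /= mpredK.
  rewrite /splits /=; apply: (@maddI (vec j)).
  by rewrite maddA [madd (vec j) _]maddC mpredK // e maddC.
- move=> _ [[a b] /= e <-]; rewrite /splits /= in e *.
  by rewrite -e -!maddA [madd (vec j) b]maddC.
rewrite fsbig_image //; apply: eq_fsbigr => -[a b] _ /=.
rewrite /wgt /= mfacS maddE vecE eqxx addn1 natrM.
have hj : (a j).+1%:R != 0 :> rat by rewrite pnatr_eq0.
by rewrite mulrCA -mulrA invfM mulVKf.
Qed.

Lemma splits_swap m (F : mtype * mtype -> rat) :
  \sum_(p \in splits m) F p = \sum_(p \in splits m) F (p.2, p.1).
Proof.
apply: reindex_fsbig; split => [[a b]|[a b] [c d] _ _ [-> ->]|[a b]] //=.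
  by rewrite /splits /= maddC.
by rewrite /splits /= => e; exists (b, a) => //=; rewrite maddC.
Qed.

Lemma sum_splits2 m j (psi : mtype * mtype -> rat) :
  \sum_(p \in splits (madd m (vec j))) (p.2 j)%:R * (psi p * wgt p) =
  \sum_(p \in splits m) psi (p.1, madd p.2 (vec j)) * wgt p.
Proof.
have wC a b : wgt (a, b) = wgt (b, a) by rewrite /wgt mulrC.
rewrite splits_swap [RHS]splits_swap /=.
under eq_fsbigr do rewrite /= wC.
rewrite (sum_splits1 m j (fun p => psi (p.2, p.1))) /=.
by apply: eq_fsbigr => -[a b] _ /=; rewrite wC.
Qed.

Lemma size_shift_sub (f : {poly rat}) c :
  (size (f \Po ('X + c%:P) - f)%R <= (size f).-1)%N.
Proof.
have [->|f0] := eqVneq f 0; first by rewrite comp_poly0 subr0 size_poly0.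
have sX : size ('X + c%:P) = 2%N by rewrite size_XaddC.
have sf : size (f \Po ('X + c%:P)) = size f by rewrite size_comp_poly2.
apply/leq_sizeP => i; rewrite coefB leq_eqVlt => /orP[/eqP<-|lt].
  have := lead_coef_comp f (q := 'X + c%:P).
  rewrite sX => /(_ isT); rewrite /lead_coef sf sX.
  rewrite coefD coefX coefC /= addr0 expr1n mulr1 => ->.
  by rewrite subrr.
have le : (size f <= i)%N by rewrite -(prednK (n := size f)) ?size_poly_gt0.
by rewrite !nth_default ?sf // subr0.
Qed.

Definition altsum m (f : {poly rat}) :=
  \sum_(p \in splits m) (-1) ^+ mdeg p.2 * f.[(mwt p.1)%:R] * wgt p.

Lemma altsum0 m (f : {poly rat}) : (size f <= mdeg m)%N -> altsum m f = 0.
Proof.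
elim: {m}(mdeg m) {-2}m (erefl (mdeg m)) f => [|n IH] m em f.
  rewrite em leqn0 size_poly_eq0 => /eqP ->; apply: fsbig1 => p _.
  by rewrite horner0 mulr0 mul0r.
move=> sf; have [j mj] := @mdegP m ltac:(by rewrite em).
have mj0 : (m j)%:R != 0 :> rat by rewrite pnatr_eq0 -lt0n.
apply: (mulfI mj0); rewrite mulr0.
have [m' em'] : exists m', m = madd m' (vec j).
  by exists (mpred m j); rewrite mpredK.
subst m; rename m' into m; rewrite /altsum mulr_fsumr.
pose psi p := (-1) ^+ mdeg p.2 * f.[(mwt p.1)%:R].
transitivity (\sum_(p \in splits (madd m (vec j)))
   ((p.1 j)%:R * (psi p * wgt p) + (p.2 j)%:R * (psi p * wgt p))).
  apply: eq_fsbigr => -[a b]; rewrite inE /splits /= => <-.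
  by rewrite maddE natrD mulrDl.
rewrite fsbig_split /=; last exact: finite_splits.
rewrite sum_splits1 sum_splits2 -fsbig_split /=; last exact: finite_splits.
rewrite -[RHS](IH m _ (f \Po ('X + (val j)%:R%:P) - f)).
- apply: eq_fsbigr => -[a b] _; rewrite /psi /= mwtS mdegS.
  rewrite hornerD hornerN horner_comp hornerD hornerX hornerC -natrD.
  by rewrite exprS mulN1r mulNr mulNr -mulrBl -mulrBr.
- by move: em; rewrite mdegS => -[].
apply: leq_trans (size_shift_sub _ _) _.
by move: sf; rewrite mdegS; case: (size f).
Qed.

Definition ffpoly n : {poly rat} := \prod_(i < n) ('X - (i%:R)%:P).

Lemma size_ffpoly n : size (ffpoly n) = n.+1.
Proof. by rewrite size_prod_XsubC /index_enum -enumT size_enum_ord. Qed.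

Lemma ffpolyE n (k : nat) : (ffpoly n).[k%:R] = (k ^_ n)%:R.
Proof.
rewrite /ffpoly horner_prod; elim: n => [|n IH]; first by rewrite big_ord0 ffactn0.
rewrite big_ord_recr /= IH hornerXsubC ffactnSr natrM.
have [le|lt] := leqP n k; first by rewrite natrB.
by rewrite ffact_small // !mul0r.
Qed.

(* Up to the factorials of a type m, hyperCatalan m is a polynomial of degree
   |m| - 1 in its weight, so its |m|-fold finite difference (altsum) vanishes;
   this inclusion-exclusion splits it into one term per removed variable. *)
Definition geode_witness : series := fun n =>
  \sum_(p \in splits n)
    (-1) ^+ mdeg p.2 / (mdeg p.2).+1%:R * (mwt p.1 ^_ mdeg n)%:R * wgt p.

Lemma hyperCatalanE m : m != mzero ->
  hyperCatalan m = (mwt m ^_ (mdeg m).-1)%:R / (mfac m)%:R.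
Proof.
move=> m0; rewrite /hyperCatalan -/(mwt m) -/(mfac m) natrM invfM mulrA.
congr (_ / _); have d0 : (0 < mdeg m)%N by rewrite lt0n mdeg_eq0.
have wE : mwt m = (\sum_(j <- finsupp m) (val j).-1 * m j + mdeg m)%N.
  rewrite /mwt /mdeg -big_split /=; apply: eq_bigr => -[[//|j] hj] _ /=.
  by rewrite mulSn addnC.
set V := (\sum_(j <- finsupp m) _)%N in wE *.
have le : ((mdeg m).-1 <= mwt m)%N.
  by rewrite wE (leq_trans (leq_pred _)) // leq_addl.
have -> : (1 + V = mwt m - (mdeg m).-1)%N.
  by rewrite wE -subn1 subnBA // addnAC addnK addnC.
rewrite -(ffact_fact le) natrM mulfK // pnatr_eq0 -lt0n; exact: fact_gt0.
Qed.

Lemma is_geode_witness : is_geode geode_witness.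
Proof.
apply/funext => m; rewrite smul_svars /= /sone /hyperCatalan_series.
have [->|m0] := eqVneq m mzero.
  by rewrite /hyperCatalan finsupp0 !big_seq_fset0 divff // subrr.
rewrite subr0 hyperCatalanE //.
have d0 : (0 < mdeg m)%N by rewrite lt0n mdeg_eq0.
pose ff a := (mwt a ^_ (mdeg m).-1)%:R : rat.
pose psi p := (-1) ^+ (mdeg p.2).-1 / (mdeg p.2)%:R * ff p.1 : rat.
have step j : j \in finsupp m -> geode_witness (mpred m j) =
    \sum_(p \in splits m) (p.2 j)%:R * (psi p * wgt p).
  rewrite in_supp => mj; rewrite -{2}(mpredK mj) sum_splits2.
  apply: eq_fsbigr => -[a b] _; rewrite /psi /ff /= mdegS /=.
  by rewrite -{2}(mpredK mj) mdegS.
rewrite (eq_big_seq _ step).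
transitivity (\sum_(p \in splits m) (mdeg p.2)%:R * (psi p * wgt p)); last first.
  rewrite fsbig_finite; last exact: finite_splits.
  under [RHS]eq_bigr do rewrite (fsbig_finite _ _ (finite_splits m)).
  rewrite exchange_big /=; apply: eq_big_seq => -[a b].
  rewrite in_fset_set; last exact: finite_splits.
  rewrite inE /splits /= => e; rewrite -mulr_suml -natr_sum sumsupp_mdeg //.
  by move=> j; rewrite -e maddE leq_addl.
have -> : (mwt m ^_ (mdeg m).-1)%:R / (mfac m)%:R = ff m * wgt (m, mzero).
  by rewrite /wgt /ff /= /(mfac mzero) finsupp0 big_seq_fset0 mulr1.
rewrite (fsbigD1 (m, mzero)) /=; first last.
- by rewrite /splits /= madd0.
- exact: finite_splits.
have dz : mdeg mzero = 0%N by apply/eqP; rewrite mdeg_eq0.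
rewrite dz mul0r add0r.
have sz : (size (ffpoly (mdeg m).-1) <= mdeg m)%N by rewrite size_ffpoly prednK.
have := altsum0 sz; rewrite /altsum (fsbigD1 (m, mzero)) /=; first last.
- by rewrite /splits /= madd0.
- exact: finite_splits.
rewrite dz expr0 mul1r ffpolyE => /eqP; rewrite addr_eq0 => /eqP ->.
apply/eqP; rewrite eq_sym -subr_eq0 opprK; apply/eqP.
rewrite -fsbig_split /=; last exact: finite_setD (finite_splits m).
apply: fsbig1 => -[a b] [] /=; rewrite /splits /= => e ne.
have b0 : (0 < mdeg b)%N.
  rewrite lt0n mdeg_eq0; apply/eqP => b0; apply: ne.
  by rewrite -e b0 madd0.
rewrite ffpolyE /psi /= -/(ff a).
have b1 : (mdeg b)%:R != 0 :> rat by rewrite pnatr_eq0 -lt0n.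
have -> : (-1) ^+ mdeg b = - (-1) ^+ (mdeg b).-1 :> rat.
  by rewrite -{1}(prednK b0) exprS mulN1r.
move: (ff a) ((-1) ^+ _) (mdeg b)%:R b1 (wgt _) => x y z z0 w.
by rewrite !mulrA [z * y]mulrC mulfK // !mulNr subrr.
Qed.

Lemma is_geode_unique G G' : is_geode G -> is_geode G' -> G = G'.
Proof.
move=> hG hG'; apply/funext => n.
have e m : \sum_(j <- finsupp m) G (mpred m j) =
           \sum_(j <- finsupp m) G' (mpred m j).
  by rewrite -!smul_svars -hG -hG'.
pose i2 := idx 2 (leqnn 2).
have [k le] := ubnP (mdeg n - n i2); elim: k => // k IH in n le *.
have := e (madd n (vec i2)).
have i2m : i2 \in finsupp (madd n (vec i2)).
  by rewrite in_supp maddE vecE eqxx addn1.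
rewrite (big_fsetD1 i2 i2m) (big_fsetD1 (F := fun j => G' _) i2 i2m) /= maddK.
set s := \sum_(_ <- _) _; set s' := \sum_(_ <- _) _.
suff -> : s = s' by move/addIr.
rewrite /s /s' !big_seq; apply: eq_bigr => j.
rewrite !inE in_supp maddE vecE => /andP[ji]; rewrite (negbTE ji) addn0 => nj.
apply: IH; move: le; rewrite ltnS; apply: leq_trans.
set n' := mpred _ j.
have dn' : mdeg n' = mdeg n.
  apply: succn_inj; rewrite -(mdegS n i2) -(mdegS n' j) mpredK //.
  by rewrite maddE ltn_addr.
have -> : n' i2 = (n i2).+1.
  by rewrite mpredE maddE vecE eqxx [i2 == j]eq_sym (negbTE ji) subn0 addn1.
by rewrite dn' ltn_sub2l // -(mpredK nj) mdegS maddE vecE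
  [i2 == j]eq_sym (negbTE ji) addn0 ltnS leq_mdeg.
Qed.

Lemma geode_exists : exists G, is_geode G.
Proof. by exists geode_witness; exact: is_geode_witness. Qed.

(* By is_geode_unique, geode is the only series satisfying is_geode. *)
Definition geode : series := projT1 (cid geode_exists).

Lemma geodeP : is_geode geode.
Proof. exact: projT2 (cid geode_exists). Qed.

Definition Hval (k m n : nat) : rat :=
  ((k * m + (k + 1) * (n + 1))`!)%N%:R /
  ((k * (m + n + 1) + 1) * (m + n + 1) *
   ((k - 1) * m + k * (n + 1))`! * m`! * n`!)%N%:R.

(* Main.v *)
(** On types supported on the two indices [k] and [k+1], the defining equation
    [S - 1 = (t_2 + t_3 + ...) G] reads [G(m,n) + G(m+1,n-1) = C(m+1,n)], where
    the second summand is absent if [n = 0].  By induction on [n] this determines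
    [G(m,n)], so it suffices that [H] satisfies the same recurrence.  With
    [D = m+n+1], clearing factorials reduces the latter to the identity
    [(kD+n+1)(m+1) + (kD-m) n = (kD+1) D]. *)
Require Import Defs.
From mathcomp Require Import all_boot all_order all_algebra.
From mathcomp Require Import finmap ring zify.

Set Implicit Arguments.
Unset Strict Implicit.
Unset Printing Implicit Defensive.

Import GRing.Theory Num.Theory.

Local Open Scope ring_scope.

Lemma geode_rec (a : mtype) : a != mzero ->
  \sum_(j <- finsupp a) geode (mpred a j) = hyperCatalan a.
Proof.
by move=> /negbTE a0; rewrite -smul_svars -geodeP /= /sone a0 subr0.
Qed.

Section TwoVariables.
Variables i j : tindex.
Hypothesis ij : i != j.

Definition bitype (a b : nat) : mtype := madd (mscale a (vec i)) (mscale b (vec j)).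

Lemma bitypeE a b l : bitype a b l = (a * (l == i) + b * (l == j))%N.
Proof. by rewrite maddE !mscaleE !vecE. Qed.

Lemma bitype_i a b : bitype a b i = a.
Proof. by rewrite bitypeE eqxx (negbTE ij) muln1 muln0 addn0. Qed.

Lemma bitype_j a b : bitype a b j = b.
Proof. by rewrite bitypeE eqxx eq_sym (negbTE ij) muln1 muln0. Qed.

Lemma finsupp_bitype a b : (finsupp (bitype a b) `<=` [fset i; j])%fset.
Proof.
apply/fsubsetP => l; rewrite in_supp bitypeE !inE.
by case: (l == i); case: (l == j); rewrite // !muln0.
Qed.

Lemma mpred_bitype_i a b : mpred (bitype a.+1 b) i = bitype a b.
Proof.
apply/fsfunP => l; rewrite mpredE !bitypeE.
by case: (l == i); rewrite ?muln1 ?muln0 ?subn0 // addSn subn1.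
Qed.

Lemma mpred_bitype_j a b : mpred (bitype a b.+1) j = bitype a b.
Proof.
apply/fsfunP => l; rewrite mpredE !bitypeE.
by case: (l == j); rewrite ?muln1 ?muln0 ?subn0 // addnS subn1.
Qed.

Lemma big_bitype (R : Type) (x : R) (op : Monoid.com_law x) (F : tindex -> R) :
  \big[op/x]_(l <- [fset i; j]%fset) F l = op (F i) (F j).
Proof. by rewrite big_fsetU1 ?inE //= big_seq_fset1. Qed.

(** Indices with entry 0 contribute 0 to the sums and 0! = 1 to the product, so all three may range
    over {i, j} even if [a] or [b] is 0. *)
Lemma hyperCatalan_bitype a b : hyperCatalan (bitype a b) =
  ((val i * a + val j * b)`!)%:R /
  ((1 + ((val i).-1 * a + (val j).-1 * b))`! * (a`! * b`!))%:R.
Proof.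
rewrite /hyperCatalan; have sB := finsupp_bitype a b.
rewrite (@big_supp _ addn (fun l c => val l * c)%N _ _ _ sB); last first.
  by move=> l; rewrite muln0.
rewrite (@big_supp _ addn (fun l c => (val l).-1 * c)%N _ _ _ sB); last first.
  by move=> l; rewrite muln0.
rewrite (@big_supp _ muln (fun _ c => c`!) _ _ _ sB) //.
by rewrite !big_bitype /= bitype_i bitype_j.
Qed.

Lemma geode_bitype_rec a b :
  geode (bitype a b) + (if b is b'.+1 then geode (bitype a.+1 b') else 0) =
  hyperCatalan (bitype a.+1 b).
Proof.
have a0 : bitype a.+1 b != mzero.
  by apply/eqP => /fsfunP/(_ i); rewrite bitype_i mzeroE.
rewrite -geode_rec //.
(* Where an entry is 0, [mpred] truncates and returns its argument, so the summand is set to 0 there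
   before the sum is extended to {i, j}. *)
transitivity (\sum_(l <- finsupp (bitype a.+1 b))
    if (0 < bitype a.+1 b l)%N then geode (mpred (bitype a.+1 b) l) else 0).
  rewrite (big_fset_incl _ (finsupp_bitype a.+1 b)); last first.
    by move=> l _; rewrite in_supp => /negbTE->.
  rewrite big_bitype bitype_i bitype_j mpred_bitype_i /=.
  by case: b a0 => // b _; rewrite mpred_bitype_j.
by apply: eq_big_seq => l; rewrite in_supp => ->.
Qed.

End TwoVariables.

(** The right-hand side is the hyper-Catalan number with [m.+1] at index k and [n] at index k+1. *)
Lemma Hval_rec k m n : (0 < k)%N ->
  Hval k m n + (if n is n'.+1 then Hval k m.+1 n' else 0) =
  ((k * m.+1 + k.+1 * n)`!)%:R /
  ((1 + (k.-1 * m.+1 + k * n))`! * (m.+1`! * n`!))%:R.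
Proof.
case: k => // k _; rewrite /Hval subn1 /=.
have -> : (k.+1 * m + (k.+1 + 1) * (n + 1) = (k.+1 * m.+1 + k.+2 * n).+1)%N by lia.
have -> : (k * m + k.+1 * (n + 1) = (k * m.+1 + k.+1 * n).+1)%N by lia.
have fne p : (p`!)%:R != 0 :> rat by rewrite pnatr_eq0 -lt0n fact_gt0.
have sne p : (p.+1)%:R != 0 :> rat by rewrite pnatr_eq0.
case: n => [|n].
  (* Here D is [m.+1], and the leading factor of the numerator factorial is kD+1, so the quotient
     cancels directly. *)
  rewrite addr0 add1n !muln0 !addn0 !factS !addn1 fact0 !natrM.
  move: (sne (k.+1 * m.+1)%N) (sne m) (sne (k * m.+1)%N).
  move: (fne (k * m.+1)%N) (fne m).
  move: (_.+1)%:R (_.+1)%:R (_.+1)%:R => *; field.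
  by do ?[apply/andP; split].
have -> : (k.+1 * m.+1 + (k.+1 + 1) * (n + 1) = k.+1 * m.+1 + k.+2 * n.+1)%N by lia.
have -> : (k * m.+1 + k.+1 * (n + 1) = k * m.+1 + k.+1 * n.+1)%N by lia.
have -> : (m.+1 + n + 1 = m + n.+1 + 1)%N by lia.
set A := (k.+1 * m.+1 + _)%N; set B := (k * m.+1 + _)%N.
rewrite add1n !addn1; set D := (m + n.+1).+1.
(* With k and n of the identity being [k.+1] and [n.+1] here, [A.+1] is kD+n+1 and [B.+1] is
   kD-m. *)
have : (A.+1 * m.+1 + B.+1 * n.+1 = (k.+1 * D).+1 * D)%N.
  by rewrite /A /B /D; ring.
(* [A] and [B] must be opaque here: [factS] would otherwise unfold them. *)
move: A B => A B /(congr1 (fun p => p%:R : rat)) key.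
rewrite natrD !natrM in key.
rewrite !factS !natrM.
have := sne (k.+1 * D)%N; have := sne (m + n.+1)%N; rewrite -/D.
move: key (sne m) (sne n) (sne B) (fne A) (fne B) (fne m) (fne n).
move: A.+1%:R m.+1%:R B.+1%:R n.+1%:R (k.+1 * D).+1%:R D%:R.
move: A`!%:R B`!%:R m`!%:R n`!%:R => fA fB fm fn a u b v e d key *.
(* Over a common denominator the numerators combine to the left side of [key]; its right side
   [e * d] then cancels. *)
transitivity (fA * (a * u + b * v) / (e * d * (b * fB * (u * fm * (v * fn))))).
  by field; do ?[apply/andP; split].
by rewrite key; field; do ?[apply/andP; split].
Qed.

Theorem theorem10 (k m n : nat) (hk : (2 <= k)%N) :
  geode (madd (mscale m (vec (idx k hk)))
              (mscale n (vec (idx k.+1 (leqW hk)))))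
  = Hval k m n.
Proof.
set i := idx k hk; set j := idx k.+1 (leqW hk).
have ij : i != j by rewrite -val_eqE /= neq_ltn ltnSn.
rewrite -/(bitype i j m n).
have H a b := etrans (geode_bitype_rec ij a b)
  (etrans (hyperCatalan_bitype ij _ _) (esym (Hval_rec a b (ltnW hk)))).
(* The recurrence lowers [n] but raises [m], so the induction hypothesis must cover all [m]. *)
elim: n m => [|n IH] m; first by have := H m 0%N; rewrite !addr0.
by have := H m n.+1; rewrite IH => /addIr.
Qed.
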